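(* Let $F$ be a distribution on $\mathbb{R}$ with a density, and let $X, X_1, X_2, \ldots$ be i.i.d. with distribution $F$, with mean $\mu = E[X]$. Suppose the tail $\bar F(x) = 1-F(x)$ satisfies $\bar F(x) = L(x)x^{-\alpha}$ for some slowly varying function $L$ and some $\alpha > 2$, and that $E|X|^{2+\delta}<\infty$ for some $\delta>0$. Let $\gamma=\gamma(n)$ satisfy $\gamma = n\mu + \omega(\sqrt{n\log n})$ as $n\to\infty$, and let the truncation level $u=u(n)$ satisfy $u = \omega\big((\gamma-n\mu)^{\beta}\big)$ for some $\beta>1$. Then, as $n\to\infty$, $$p(\tilde F_u) - p(F) = o(p(F)).$$
   Context: $S_n = X_1+\cdots+X_n$. For a distribution $G$ on $\mathbb{R}$, $p(G) = P_G(S_n>\gamma)$ denotes the probability that $S_n>\gamma$ when $X_1,\ldots,X_n$ are i.i.d. with distribution $G$. The truncated distribution $\tilde F_u$ is defined by $\tilde F_u(x) = F(x)/F(u)$ for $x\le u$ and $\tilde F_u(x)=1$ for $x>u$. Asymptotic notation: $a_n=o(b_n)$ means $a_n/b_n\to0$; $a_n=\omega(b_n)$ means $a_n/b_n\to\infty$. *)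

(* Defs.v *)
From HB Require Import structures.
From mathcomp Require Import all_boot all_order all_algebra.
From mathcomp Require Import all_classical all_reals all_analysis.
Set Implicit Arguments. Unset Strict Implicit. Unset Printing Implicit Defensive.
Import Order.TTheory GRing.Theory Num.Theory.
Import numFieldNormedType.Exports.
Local Open Scope classical_set_scope.
Local Open Scope ring_scope.

(* P_G(S_n > g) for X_1..X_n iid ~ G, written as the iterated integral
   Q_0(s) = 1[s > g],  Q_{k+1}(s) = \int Q_k(s + x) dG(x),
   P_G(S_n > g) = Q_n(0)  (Fubini-Tonelli on the product measure G^n). *)
Fixpoint iter_tail {R : realType} (G : {measure set R -> \bar R}) (g : R)
  (k : nat) (s : R) : \bar R :=
  match k with
  | 0 => ((g < s)%R%:R)%:E
  | k.+1 => (\int[G]_x iter_tail G g k (s + x))%E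
  end.

Definition psum {R : realType} (G : {measure set R -> \bar R}) (n : nat) (g : R)
  : \bar R := iter_tail G g n 0.

Definition cdfF {R : realType} (P : probability R R) (x : R) : R :=
  fine (P `]-oo, x]%classic).

Lemma cdfF_inv_ge0 {R : realType} (P : probability R R) (u : R) :
  0 <= (cdfF P u)^-1.
Proof. by rewrite invr_ge0 /cdfF fine_ge0 // measure_ge0. Qed.

Definition trunc_scale {R : realType} (P : probability R R) (u : R) : {nonneg R} :=
  NngNum (cdfF_inv_ge0 P u).

Definition trunc {R : realType} (P : probability R R) (u : R)
  : {measure set R -> \bar R} :=
  mscale (trunc_scale P u) (mrestr P (measurable_itv `]-oo, u])).

Definition slowly_varying {R : realType} (L : R -> R) : Prop :=
  measurable_fun (`]0, +oo[%classic : set R) L /\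
  (\forall x \near +oo, 0 < L x) /\
  (forall lam : R, 0 < lam -> (fun x => L (lam * x) / L x) @ +oo --> (1 : R)).

(* Main.v *)
(* Swapping the n summands from F to its truncation at u one at a time
   changes P(S_n > gamma) by at most n Fbar(u), so it suffices that
   n Fbar(u) = o(p(F)).  With y = gamma - n mu, a single jump beyond mu + 2 y
   and a remainder within y of its mean force S_n > gamma; since n / y^2 -> 0,
   Chebyshev's inequality yields p(F) >= n q / 2 for q = Fbar(mu + 2 y), and
   q >= Fbar(3 y).  As u exceeds every fixed multiple of y, regular variation of
   Fbar gives Fbar(u) = o(Fbar(3 y)). *)
Require Import Defs.
From HB Require Import structures.
From mathcomp Require Import all_boot all_order all_algebra.
From mathcomp Require Import all_classical all_reals all_analysis.
From mathcomp Require Import measurable_realfun.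
From mathcomp Require Import ring lra.
Import Order.TTheory GRing.Theory Num.Theory.
Import numFieldNormedType.Exports.
Local Open Scope classical_set_scope.
Local Open Scope ring_scope.


(** * Tail probabilities of sums under measures of mass one *)

Section UnitMass.
Context {R : realType}.
Implicit Types (G P : {measure set R -> \bar R}) (q : R -> R).

Lemma unit_mass_integrable G (A : set R) q : G setT = 1%E -> measurable A ->
  measurable_fun setT q -> (forall x, 0 <= q x <= 1) ->
  G.-integrable A (EFin \o q).
Proof.
move=> G1 mA mq q01; apply: measurable_bounded_integrable => //.
- apply: le_lt_trans (ltry 1); rewrite -G1.
  by apply: le_measure; rewrite ?inE.
- exact: measurable_funTS.
- exists 1; split=> // M M1 x _ /=; have /andP[q0 q1] := q01 x.
  by rewrite ger0_norm// (le_trans q1)// ltW.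
Qed.

Lemma unit_mass_integrable_cst G (A : set R) (c : R) : G setT = 1%E ->
  measurable A -> G.-integrable A (EFin \o (fun=> c)).
Proof.
move=> G1 mA; apply: measurable_bounded_integrable => //.
- by apply: le_lt_trans (ltry 1); rewrite -G1; apply: le_measure; rewrite ?inE.
- by exists `|c|; split=> // M M1 x _ /=; rewrite ltW.
Qed.

Lemma unit_mass_Rintegral_cst G (c : R) : G setT = 1%E -> \int[G]_x c = c.
Proof. by move=> G1; rewrite Rintegral_cst// G1/= mulr1. Qed.

Lemma Rintegral_itv_split G (a : R) q : G.-integrable setT (EFin \o q) ->
  \int[G]_x q x =
    \int[G]_(x in `]-oo, a]) q x + \int[G]_(x in `]a, +oo[) q x.
Proof.
move=> iq; have E : (setT : set R) = `]-oo, a] `|` `]a, +oo[.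
  apply/esym/seteqP; split=> // x _ /=; rewrite !in_itv/= andbT.
  by case: (leP x a) => _; [left|right].
rewrite {1}E Rintegral_setU// -?E//.
by apply/disj_setPS => x [/=]; rewrite !in_itv/= andbT => xa /(le_lt_trans xa); rewrite ltxx.
Qed.

Lemma Rintegral_le_mass G (A : set R) q : G setT = 1%E -> measurable A ->
  measurable_fun setT q -> (forall x, 0 <= q x <= 1) ->
  0 <= \int[G]_(x in A) q x <= fine (G A).
Proof.
move=> G1 mA mq q01; apply/andP; split.
  by apply: Rintegral_ge0 => x _; case/andP: (q01 x).
rewrite -[leRHS]mul1r -Rintegral_cst//; apply: le_Rintegral => //.
- exact: unit_mass_integrable.
- exact: unit_mass_integrable_cst.
- by move=> x _; case/andP: (q01 x).
Qed.

(** The two facts are proved together: the bounds make the integrand real-valued, monotonicity in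
    [s] then makes it measurable, and both are needed to compare integrals at the next step. *)
Lemma iter_tail_unit_mono G (g : R) k : G setT = 1%E ->
  (forall s, (0 <= iter_tail G g k s <= 1)%E) /\
  {homo iter_tail G g k : s t / s <= t >-> (s <= t)%E}.
Proof.
move=> G1; elim: k => [|k [IHb IHm]] /=.
  split=> [s|s t st]; first by case: ltP => _; rewrite !lee_fin ?lexx ler01.
  by rewrite lee_fin ler_nat; case: (ltP g s) => // /lt_le_trans /(_ st) ->.
have mI (s : R) : measurable_fun (setT : set R)
      (iter_tail G g k \o +%R s : R -> \bar R).
  have -> : (iter_tail G g k \o +%R s : R -> \bar R) =
      EFin \o (fun x : R => fine (iter_tail G g k (s + x))).
    apply/funext => x /=; rewrite fineK// ge0_fin_numE; last by have /andP[] := IHb (s + x).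
    by have /andP[] := IHb (s + x) => _ /le_lt_trans; apply; rewrite ltry.
  apply/measurable_EFinP; apply: nondecreasing_measurable => // x y xy.
  apply: fine_le; last by apply: IHm; rewrite lerD2l.
  - rewrite ge0_fin_numE; last by have /andP[] := IHb (s + x).
    by apply: le_lt_trans (ltry 1); have /andP[] := IHb (s + x).
  - rewrite ge0_fin_numE; last by have /andP[] := IHb (s + y).
    by apply: le_lt_trans (ltry 1); have /andP[] := IHb (s + y).
split=> [s|s t st].
  rewrite integral_ge0 /=; last by move=> x _; have /andP[] := IHb (s + x).
  apply: (@le_trans _ _ (\int[G]_x (cst 1 x))%E).
    apply: ge0_le_integral => //.
    - by move=> x _; have /andP[] := IHb (s + x).
    - exact: mI.
    - by move=> x _; have /andP[] := IHb (s + x).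
  by rewrite integral_cst// G1 mul1e.
apply: ge0_le_integral => //.
- by move=> x _; have /andP[] := IHb (s + x).
- exact: mI.
- exact: mI.
- by move=> x _; apply: IHm; rewrite lerD2r.
Qed.

(** Taking [fine] loses nothing for a measure of mass one, where the values lie in [0, 1]. *)
Definition tail_prob G (g : R) k (s : R) : R := fine (iter_tail G g k s).

Lemma iter_tailE G (g : R) k s : G setT = 1%E ->
  iter_tail G g k s = (tail_prob G g k s)%:E.
Proof.
move=> G1; have /andP[h0 h1] := (iter_tail_unit_mono G g k G1).1 s.
by rewrite fineK// ge0_fin_numE// (le_lt_trans h1)// ltry.
Qed.

Lemma tail_prob01 G (g : R) k s : G setT = 1%E -> 0 <= tail_prob G g k s <= 1.
Proof.
move=> G1; rewrite -!lee_fin -iter_tailE//.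
exact: (iter_tail_unit_mono G g k G1).1.
Qed.

Lemma measurable_tail_prob G (g : R) k s : G setT = 1%E ->
  measurable_fun (setT : set R) (fun x : R => tail_prob G g k (s + x) : R).
Proof.
move=> G1; apply: nondecreasing_measurable => // x y xy.
rewrite -lee_fin -!iter_tailE//.
by apply: (iter_tail_unit_mono G g k G1).2; rewrite lerD2l.
Qed.

Lemma tail_probS G (g : R) k s : G setT = 1%E ->
  tail_prob G g k.+1 s = \int[G]_x tail_prob G g k (s + x).
Proof.
by move=> G1; congr fine => /=; apply: eq_integral => x _; rewrite iter_tailE.
Qed.

Lemma integrable_tail_prob G P (A : set R) (g : R) k s :
  G setT = 1%E -> P setT = 1%E -> measurable A ->
  P.-integrable A (EFin \o (fun x : R => tail_prob G g k (s + x))).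
Proof.
move=> G1 P1 mA; apply: unit_mass_integrable => //.
- exact: measurable_tail_prob.
- by move=> x; exact: tail_prob01.
Qed.

(* Replacing the law of one summand at a time costs at most [d] each. *)
Lemma tail_prob_close G P (d : R) : G setT = 1%E -> P setT = 1%E ->
  (forall q, measurable_fun setT q -> (forall x, 0 <= q x <= 1) ->
    `|\int[G]_x q x - \int[P]_x q x| <= d) ->
  forall g k s, `|tail_prob G g k s - tail_prob P g k s| <= k%:R * d.
Proof.
move=> G1 P1 hd g; elim=> [|k IH] s; first by rewrite subrr normr0 mul0r.
rewrite !tail_probS//.
(* The inserted term integrates the [G]-tail of the remaining [k] summands against [P]. One
   difference then changes only the law of the first summand and costs [d]; the other is controlled
   by induction. *)
rewrite -(subrKA (\int[P]_x tail_prob G g k (s + x))) mulrSr mulrDl mul1r addrC.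
apply: le_trans (ler_normD _ _) _; apply: lerD; last first.
  apply: hd; first exact: measurable_tail_prob.
  by move=> x; exact: tail_prob01.
have iG := @integrable_tail_prob G P setT g k s G1 P1 measurableT.
have iP := @integrable_tail_prob P P setT g k s P1 P1 measurableT.
have iB : P.-integrable setT
    (EFin \o (fun x : R => tail_prob G g k (s + x) - tail_prob P g k (s + x))).
  exact: (integrableB measurableT iG iP).
rewrite -RintegralB//; apply: le_trans (le_normr_Rintegral _ _) _ => //.
rewrite -[leRHS](unit_mass_Rintegral_cst P)//; apply: le_Rintegral => //.
- exact: integrable_norm.
- exact: unit_mass_integrable_cst.
Qed.

End UnitMass.

(** * Cost of replacing a law by its truncation *)

Section Trunc.
Context {R : realType}.
Variables (P : probability R R) (u : R).
Hypothesis Fu : 0 < cdfF P u.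

Lemma fine_prob_gt : fine (P `]u, +oo[%classic) = 1 - cdfF P u.
Proof.
have P1 : P setT = 1%E by exact: probability_setT.
have := Rintegral_itv_split P u _ (unit_mass_integrable_cst P _ 1 P1 measurableT).
rewrite unit_mass_Rintegral_cst// !Rintegral_cst// !mul1r /cdfF => ->.
by rewrite addrC addKr.
Qed.

Lemma Rintegral_trunc (q : R -> R) : measurable_fun setT q -> (forall x, 0 <= q x <= 1) ->
  \int[trunc P u]_x q x = (cdfF P u)^-1 * \int[P]_(x in `]-oo, u]) q x.
Proof.
move=> mq q01; have mI := measurable_itv `]-oo, u].
have q0 x : (0 <= (q x)%:E)%E by rewrite lee_fin; case/andP: (q01 x).
have mqE : measurable_fun setT (EFin \o q) by exact/measurable_EFinP.
rewrite /Rintegral /trunc ge0_integral_mscale//.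
have E : (\int[mrestr P mI]_x (q x)%:E =
    \int[P]_(x in `]-oo, u]) (q x)%:E)%E.
  rewrite -(setUv `]-oo, u]%classic) ge0_integral_setU//; last 3 first.
  - exact: measurableC.
  - by rewrite setUv.
  - by apply/disj_setPS => x [].
  rewrite [X in (_ + X)%E]null_set_integral ?adde0; last 3 first.
  - exact: measurableC.
  - exact: measurable_funTS.
  - exact: (etrans (congr1 P (setICl _)) (measure0 P)).
  by apply: eq_measure_integral => A mA Au; exact: (congr1 P (setIidl Au)).
rewrite E fineM//.
have := @unit_mass_integrable _ P _ q (@probability_setT _ _ _ P) mI mq q01.
by move/integrable_fin_num; apply.
Qed.

Lemma trunc_setT : trunc P u setT = 1%E.
Proof.
rewrite -[LHS]/(((cdfF P u)^-1)%:E * P (setT `&` `]-oo, u]%classic))%E setTI.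
have fP : P `]-oo, u]%classic \is a fin_num by apply: fin_num_measure.
rewrite -[X in (_ * X)%E]fineK// -EFinM mulVf// gt_eqF//.
Qed.

(** Let [a] and [b] be the integrals of [q] below and above [u], and [F = cdfF P u]. The difference
    is [(1 - F) * (a / F) - b], and since [a <= F] both terms lie between 0 and [1 - F]. *)
Lemma trunc_close (q : R -> R) : measurable_fun setT q -> (forall x, 0 <= q x <= 1) ->
  `|\int[trunc P u]_x q x - \int[P]_x q x| <= fine (P `]u, +oo[%classic).
Proof.
move=> mq q01; rewrite Rintegral_trunc// (@Rintegral_itv_split _ P u); last first.
  by apply: unit_mass_integrable => //; exact: probability_setT.
have P1 := @probability_setT _ _ _ P.
have /andP[a0 aF] := Rintegral_le_mass P _ q P1 (measurable_itv `]-oo, u]) mq q01.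
have /andP[b0 bF] := Rintegral_le_mass P _ q P1 (measurable_itv `]u, +oo[) mq q01.
rewrite [X in _ <= X]fine_prob_gt in bF.
move: a0 aF b0 bF; rewrite -/(cdfF P u).
set a := Rintegral _ _ _; set b := Rintegral _ _ _; set F := cdfF P u => a0 aF b0 bF.
have E : F^-1 * a - a = (1 - F) * (F^-1 * a).
  by field; rewrite gt_eqF.
have c1 : F^-1 * a <= 1 by rewrite mulrC ler_pdivrMr// mul1r.
have c0 : 0 <= F^-1 * a by rewrite mulr_ge0// invr_ge0 ltW.
have F1 : 0 <= 1 - F by lra.
rewrite opprD addrA E ler_norml; have p0 := mulr_ge0 F1 c0; rewrite fine_prob_gt -/F.
apply/andP; split; first lra.
have p1 : (1 - F) * (F^-1 * a) <= 1 - F by rewrite ler_piMr.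
lra.
Qed.

Lemma psum_trunc_close g n :
  `|fine (psum (trunc P u) n g) - fine (psum P n g)| <=
    n%:R * fine (P `]u, +oo[%classic).
Proof.
apply: tail_prob_close; [exact: trunc_setT|exact: probability_setT|].
exact: trunc_close.
Qed.

End Trunc.

(** * Second-moment bounds, with [v] the variance of one summand *)

Section SecondMoment.
Context {R : realType}.
Variables (P : {measure set R -> \bar R}) (mu v : R).
Hypotheses (P1 : P setT = 1%E)
  (iX : P.-integrable setT (EFin \o (fun x : R => x)))
  (iX2 : P.-integrable setT (EFin \o (fun x : R => x ^+ 2)))
  (EX : \int[P]_x x = mu) (EX2 : \int[P]_x (x ^+ 2) = mu ^+ 2 + v).

Lemma integrable_quadratic (a b c : R) :
  P.-integrable setT (EFin \o (fun x : R => a + b * x + c * x ^+ 2)).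
Proof.
have ia : P.-integrable setT (EFin \o (fun x : R => a)).
  exact: unit_mass_integrable_cst.
have ib := integrableZl measurableT b iX.
have ic := integrableZl measurableT c iX2.
exact: (integrableD measurableT (integrableD measurableT ia ib) ic).
Qed.

Lemma Rintegral_quadratic (a b c : R) :
  \int[P]_x (a + b * x + c * x ^+ 2) = a + b * mu + c * (mu ^+ 2 + v).
Proof.
have ia : P.-integrable setT (EFin \o (fun x : R => a)).
  exact: unit_mass_integrable_cst.
have ib : P.-integrable setT (EFin \o (fun x : R => b * x)).
  exact: (integrableZl measurableT b iX).
rewrite RintegralD//; last first.
- exact: (integrableZl measurableT c iX2).
- exact: (integrableD measurableT ia ib).
by rewrite RintegralD// unit_mass_Rintegral_cst// !RintegralZl// EX EX2.
Qed.

Lemma integrable_square_shift (a c d : R) :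
  P.-integrable setT (EFin \o (fun x : R => a + c * (d + x) ^+ 2)).
Proof.
rewrite (_ : (fun _ => _) =
    (fun x : R => (a + c * d ^+ 2) + (c * d *+ 2) * x + c * x ^+ 2)).
  exact: integrable_quadratic.
by apply/funext => x; ring.
Qed.

(** Averaging over one summand moves the centre by [mu] and adds one [v]; this drives the inductions
    on the number of summands below. *)
Lemma Rintegral_square_shift (a c d : R) :
  \int[P]_x (a + c * (d + x) ^+ 2) = a + c * ((d + mu) ^+ 2 + v).
Proof.
rewrite (_ : (fun _ => _) =
    (fun x : R => (a + c * d ^+ 2) + (c * d *+ 2) * x + c * x ^+ 2)).
  by rewrite Rintegral_quadratic; ring.
by apply/funext => x; ring.
Qed.

Lemma centered_second_moment_ge0 : 0 <= v.
Proof.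
have := Rintegral_square_shift 0 1 (- mu).
rewrite addNr expr0n/= !add0r mul1r => <-.
by apply: Rintegral_ge0 => x _; rewrite add0r mul1r sqr_ge0.
Qed.

(* The slack [b <= s] makes the bound usable after a summand exceeding a known
   level, without appealing to monotonicity in [s]. *)
Lemma tail_prob_chebyshev (m t : R) (k : nat) (b s : R) : 0 < t -> b <= s ->
  1 - tail_prob P (m - t) k s <=
    (k%:R * v + (b + k%:R * mu - m) ^+ 2) / t ^+ 2.
Proof.
move=> t0; have t20 : 0 < t ^+ 2 by rewrite exprn_gt0.
have v0 := centered_second_moment_ge0.
elim: k b s => [|k IH] b s bs.
  rewrite /tail_prob /= !mul0r add0r addr0; case: ltP => [_|sg] /=.
    by rewrite subrr divr_ge0// sqr_ge0.
  (* No summand is left and [s <= m - t], so [b <= s] gives [m - b >= t] and the right-hand side is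
     at least 1. *)
  rewrite subr0 ler_pdivlMr// mul1r.
  rewrite -ler_sqrt ?sqr_ge0// !sqrtr_sqr gtr0_norm// ler0_norm; lra.
rewrite tail_probS// lerBlDl -lerBlDr.
(* The bound for [k.+1] summands is exactly the average over [x] of the bound for [k] summands
   started at [b + x]. *)
have E : 1 - (k.+1%:R * v + (b + k.+1%:R * mu - m) ^+ 2) / t ^+ 2 =
    \int[P]_x ((1 - k%:R * v / t ^+ 2) +
      (- (t ^+ 2)^-1) * ((b + k%:R * mu - m) + x) ^+ 2).
  rewrite Rintegral_square_shift -natr1; field; exact: lt0r_neq0.
rewrite E; apply: le_Rintegral => //.
- exact: integrable_square_shift.
- exact: integrable_tail_prob.
move=> x _; have := IH (b + x) (s + x); rewrite lerD2r => /(_ bs).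
rewrite lerBlDl -lerBlDr; apply: le_trans.
rewrite le_eqVlt; apply/orP; left; apply/eqP.
by field; exact: lt0r_neq0.
Qed.

(* Keeping the quadratic in [s] rather than fixing [s = 0] is what lets the bound
   pass through the integral over the first summand; the loss [k q] pays for
   multiple big jumps. *)
Lemma tail_prob_big_jump (m y q : R) (k : nat) (s : R) : 0 < y ->
  q = fine (P `]mu + y *+ 2, +oo[%classic) ->
  k%:R * q * (1 - ((s + k%:R * mu - m) ^+ 2 + k%:R * v) / y ^+ 2 - k%:R * q)
    <= tail_prob P (m + y) k s.
Proof.
move=> y0 qE; have y20 : 0 < y ^+ 2 by rewrite exprn_gt0.
have v0 := centered_second_moment_ge0.
have q0 : 0 <= q by rewrite qE fine_ge0// measure_ge0.
elim: k s => [|k IH] s.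
  by rewrite !mul0r; case/andP: (tail_prob01 P (m + y) 0 s P1).
rewrite tail_probS// (Rintegral_itv_split P (mu + y *+ 2)); last first.
  exact: integrable_tail_prob.
have mJ : measurable (`]mu + y *+ 2, +oo[%classic : set R) by [].
have mI : measurable (`]-oo, mu + y *+ 2]%classic : set R) by [].
pose D := s + k.+1%:R * mu - m.
(* After a jump the sum starts above [s + (mu + y *+ 2)]. Chebyshev centred at [m + y *+ 2] with
   [t = y] has threshold [m + y], and the shifts [y *+ 2] cancel, leaving the offset [D]. *)
have jump : q * (1 - (D ^+ 2 + k%:R * v) / y ^+ 2) <=
    \int[P]_(x in `]mu + y *+ 2, +oo[) tail_prob P (m + y) k (s + x).
  rewrite [X in X <= _]mulrC qE -Rintegral_cst//; apply: le_Rintegral => //.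
  - exact: unit_mass_integrable_cst.
  - exact: integrable_tail_prob.
  move=> x /=; rewrite in_itv/= andbT => xa.
  have := @tail_prob_chebyshev (m + y *+ 2) y k (s + (mu + y *+ 2)) (s + x) y0.
  rewrite lerD2l (ltW xa) => /(_ isT).
  rewrite (_ : m + y *+ 2 - y = m + y); last by ring.
  rewrite (_ : s + (mu + y *+ 2) + k%:R * mu - (m + y *+ 2) = D); last first.
    by rewrite /D -natr1; ring.
  by rewrite [_ + D ^+ 2]addrC; lra.
(* [H] is the induction hypothesis as a function of the first summand. Its integral over the whole
   line is explicit, so the part without a jump is obtained by subtracting the part beyond the jump
   level. *)
pose H x := k%:R * q *
  (1 - ((s + x + k%:R * mu - m) ^+ 2 + k%:R * v) / y ^+ 2 - k%:R * q).
have HE : H = (fun x : R => k%:R * q * (1 - k%:R * v / y ^+ 2 - k%:R * q) +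
     (- (k%:R * q / y ^+ 2)) * ((s + k%:R * mu - m) + x) ^+ 2).
  by apply/funext => x; rewrite /H; field; exact: lt0r_neq0.
have iH : P.-integrable setT (EFin \o H).
  by rewrite HE; exact: integrable_square_shift.
have EH : \int[P]_x H x =
    k%:R * q * (1 - (D ^+ 2 + v + k%:R * v) / y ^+ 2 - k%:R * q).
  rewrite HE Rintegral_square_shift /D -natr1; field; exact: lt0r_neq0.
have rest : \int[P]_(x in `]-oo, mu + y *+ 2]) H x <=
    \int[P]_(x in `]-oo, mu + y *+ 2]) tail_prob P (m + y) k (s + x).
  apply: le_Rintegral => //.
  - exact: integrableS iH.
  - exact: integrable_tail_prob.
  - by move=> x _; exact: IH.
(* The last factor of [H] is at most 1 and the jump region has mass [q]: this is the price of
   counting several jumps. *)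
have Hle : \int[P]_(x in `]mu + y *+ 2, +oo[) H x <= k%:R * q * q.
  rewrite [X in _ * X]qE -Rintegral_cst//; apply: le_Rintegral => //.
  - exact: integrableS iH.
  - exact: unit_mass_integrable_cst.
  move=> x _; apply: ler_piMr; first by rewrite mulr_ge0.
  have : 0 <= ((s + x + k%:R * mu - m) ^+ 2 + k%:R * v) / y ^+ 2.
    by rewrite divr_ge0 ?addr_ge0 ?sqr_ge0 ?mulr_ge0.
  have : 0 <= k%:R * q by rewrite mulr_ge0.
  lra.
have := Rintegral_itv_split P (mu + y *+ 2) _ iH; rewrite EH.
move=> split_eq; rewrite -/D.
apply: le_trans (lerD rest jump).
move: split_eq Hle; set A := Rintegral _ _ H; set B := Rintegral _ _ H.
set w := v / y ^+ 2; have w0 : 0 <= w by rewrite divr_ge0// ltW.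
rewrite (_ : (D ^+ 2 + v + k%:R * v) / y ^+ 2 = D ^+ 2 / y ^+ 2 + w + k%:R * w); last first.
  by rewrite /w; ring.
rewrite (_ : (D ^+ 2 + k%:R * v) / y ^+ 2 = D ^+ 2 / y ^+ 2 + k%:R * w); last first.
  by rewrite /w; ring.
rewrite (_ : (D ^+ 2 + k.+1%:R * v) / y ^+ 2 = D ^+ 2 / y ^+ 2 + k.+1%:R * w); last first.
  by rewrite /w; ring.
rewrite -natr1; set K := k%:R; set z := _ / _ => split_eq Hle.
(* The two sides differ by the slack [q * w + (K + 1) * (q * q)], which is nonnegative. *)
have K0 : 0 <= K by [].
have qw : 0 <= q * w by rewrite mulr_ge0.
have Kqq : 0 <= K * (q * q) by rewrite !mulr_ge0.
have qq : 0 <= q * q by rewrite mulr_ge0.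
lra.
Qed.

(** The variance integral is restricted to the half-line beyond [mu + y]. Applied to a single
    summand, this will make the multiple-jump loss [n q] small. *)
Lemma tail_chebyshev (y : R) : 0 < y ->
  fine (P `]mu + y, +oo[%classic) * y ^+ 2 <= v.
Proof.
move=> y0; have i2 := integrable_square_shift 0 1 (- mu).
have := Rintegral_square_shift 0 1 (- mu).
rewrite addNr expr0n/= !add0r mul1r => vE.
rewrite -[leRHS]vE (Rintegral_itv_split P (mu + y))//.
rewrite -[leLHS]add0r; apply: lerD.
  by apply: Rintegral_ge0 => x _; rewrite add0r mul1r sqr_ge0.
rewrite mulrC -Rintegral_cst//; apply: le_Rintegral => //.
- exact: unit_mass_integrable_cst.
- exact: integrableS i2.
move=> x /=; rewrite in_itv/= andbT => xa; rewrite add0r mul1r.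
rewrite ler_sqr ?nnegrE; lra.
Qed.

End SecondMoment.

(** * Integrability from the moment of order [2 + delta] *)

Section Moments.
Context {R : realType}.
Variables (P : {measure set R -> \bar R}) (delta : R).
Hypotheses (P1 : P setT = 1%E) (delta0 : 0 < delta)
  (hmom : (\int[P]_x (`|x| `^ (2 + delta))%:E < +oo)%E).

(** The square is dominated by 1 plus the power of order [2 + delta], checked separately for
    [|x| <= 1] and [|x| > 1]. *)
Lemma integrable_sqr_of_moment : P.-integrable setT (EFin \o (fun x : R => x ^+ 2)).
Proof.
have ip : P.-integrable setT (EFin \o (fun x : R => `|x| `^ (2 + delta))).
  apply/integrableP; split.
    apply/measurable_EFinP.
    apply: (measurableT_comp (f := fun x : R => x `^ (2 + delta))).
      exact: measurable_powR.
    exact: normr_measurable.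
  by under eq_integral do rewrite /= ger0_norm ?powR_ge0//.
have i1 : P.-integrable setT (EFin \o (fun x : R => 1)).
  exact: unit_mass_integrable_cst.
apply: (le_integrable measurableT _ _ (integrableD measurableT i1 ip)).
  by apply/measurable_EFinP; exact: exprn_measurable.
move=> x _ /=; rewrite lee_fin [leLHS]ger0_norm ?sqr_ge0// [leRHS]ger0_norm ?addr_ge0 ?powR_ge0//.
rewrite -real_normK ?num_real//; have [x1|x1] := leP `|x| 1.
  by rewrite (le_trans (exprn_ile1 _ _ x1))// lerDl powR_ge0.
by rewrite -powR_mulrn// -[leLHS]add0r lerD// ler_powR ?ltW// ltrDl.
Qed.

Lemma integrable_id_of_moment : P.-integrable setT (EFin \o (fun x : R => x)).
Proof.
have i1 : P.-integrable setT (EFin \o (fun x : R => 1)).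
  exact: unit_mass_integrable_cst.
apply: (le_integrable measurableT _ _
  (integrableD measurableT i1 integrable_sqr_of_moment)).
  by apply/measurable_EFinP; exact: measurable_id.
move=> x _ /=; rewrite lee_fin [leRHS]ger0_norm ?addr_ge0 ?sqr_ge0//.
rewrite -[x ^+ 2]real_normK ?num_real//.
have := sqr_ge0 (`|x| - 1); have := normr_ge0 x; nra.
Qed.

End Moments.

(** * Regular variation and growth rates *)

(** One fixed dilation suffices: [lam >= 2 / eps] and [alpha >= 1] make the power factor at most
    [eps / 2], while slow variation eventually bounds the ratio of the [L] values by 2. *)
Lemma regular_tail_ratio (R : realType) (F L : R -> R) (alpha eps : R) :
  slowly_varying L -> 1 <= alpha ->
  (forall x, 0 < x -> F x = L x * x `^ (- alpha)) -> 0 < eps ->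
  exists2 lam, 1 <= lam & \forall x \near +oo, F (lam * x) <= eps * F x.
Proof.
move=> [_ [Lpos Lrat]] alpha1 FE eps0.
pose lam := Num.max 1 (2 / eps).
have lam1 : 1 <= lam by rewrite le_max lexx.
have lam0 : 0 < lam by exact: lt_le_trans lam1.
have lamE : lam `^ (- alpha) <= eps / 2.
  apply: (@le_trans _ _ (lam^-1)).
    by rewrite -(powR_inv1 (ltW lam0)) ler_powR// lerN2.
  rewrite -[leRHS]invrK lef_pV2 ?posrE ?invr_gt0 ?divr_gt0//.
  by rewrite invf_div le_max lexx orbT.
exists lam => //.
have := Lrat _ lam0 => /cvgrPdist_lt/(_ _ (@ltr01 R)) Lr.
near=> x.
have x0 : 0 < x by near: x; exact: nbhs_pinfty_gt.
have Lx : 0 < L x by near: x.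
have Lx2 : L (lam * x) <= 2 * L x.
  rewrite -ler_pdivrMr//.
  have : `|1 - L (lam * x) / L x| < 1 by near: x.
  by rewrite ltr_norml => /andP[]; lra.
rewrite !FE ?mulr_gt0// (powRM _ (ltW lam0) (ltW x0)).
have p0 : 0 <= x `^ (- alpha) by rewrite powR_ge0.
have l0 : 0 <= lam `^ (- alpha) by rewrite powR_ge0.
apply: (@le_trans _ _ (2 * L x * (eps / 2 * x `^ (- alpha)))).
  apply: (@le_trans _ _ (2 * L x * (lam `^ (- alpha) * x `^ (- alpha)))).
    by rewrite ler_wpM2r// mulr_ge0.
  by rewrite ler_wpM2l ?ler_wpM2r// mulr_ge0// ltW.
by rewrite le_eqVlt; apply/orP; left; apply/eqP; field.
Unshelve. all: by end_near. Qed.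

(** For [n >= e] the logarithm is at least 1, so [sqrt (n ln n)] dominates [sqrt n]. Chebyshev uses
    this as [n / y^2 -> 0]. *)
Lemma sqrt_le_of_cvg (R : realType) (y : nat -> R) :
  (fun n : nat => y n / Num.sqrt (n%:R * ln n%:R)) @ \oo --> +oo ->
  forall K, 0 <= K -> \forall n \near \oo, K * Num.sqrt n%:R <= y n.
Proof.
move=> /cvgryPge yoo K K0; near=> n.
have n1 : expR 1 <= n%:R :> R by near: n; exact: nbhs_infty_ger.
have n0 : 0 < n%:R :> R by rewrite (lt_le_trans _ n1)// expR_gt0.
have ln1 : 1 <= ln n%:R :> R.
  by rewrite -[leLHS](@expRK R) ler_ln ?posrE ?expR_gt0.
have s0 : 0 < Num.sqrt (n%:R * ln n%:R) :> R.
  by rewrite sqrtr_gt0 mulr_gt0// (lt_le_trans ltr01).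
have : K <= y n / Num.sqrt (n%:R * ln n%:R) by near: n; exact: yoo.
rewrite ler_pdivlMr//; apply: le_trans; rewrite ler_wpM2l//.
by rewrite ler_wsqrtr// ler_pMr.
Unshelve. all: by end_near. Qed.

(** * Assembly of the estimates for large [n] *)

Theorem theorem2 (R : realType) (P : probability R R)
  (f : R -> R)
  (hf_meas : measurable_fun setT f) (hf_ge0 : forall x, 0 <= f x)
  (hdens : forall A : set R, measurable A ->
     P A = (\int[lebesgue_measure]_(x in A) (f x)%:E)%E)
  (mu : R) (hmu : (\int[P]_x x%:E)%E = mu%:E)
  (alpha : R) (halpha : 2 < alpha) (L : R -> R) (hL : slowly_varying L)
  (htail : forall x : R, 0 < x -> P `]x, +oo[%classic = (L x * x `^ (- alpha))%:E)
  (delta : R) (hdelta : 0 < delta)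
  (hmom : (\int[P]_x (`|x| `^ (2 + delta))%:E < +oo)%E)
  (gamma : nat -> R)
  (hgamma : (fun n : nat => (gamma n - n%:R * mu) / Num.sqrt (n%:R * ln n%:R))
              @ \oo --> +oo)
  (beta : R) (hbeta : 1 < beta) (u : nat -> R)
  (hu : (fun n : nat => u n / (gamma n - n%:R * mu) `^ beta) @ \oo --> +oo) :
  forall eps : R, 0 < eps -> \forall n \near \oo,
    `| fine (psum (trunc P (u n)) n (gamma n)) - fine (psum P n (gamma n)) |
      <= eps * `| fine (psum P n (gamma n)) |.
Proof.
move=> eps eps0.
have P1 : P setT = 1%E by exact: probability_setT.
have iX := integrable_id_of_moment P delta P1 hdelta hmom.
have iX2 := integrable_sqr_of_moment P delta P1 hdelta hmom.
have EX : \int[P]_x x = mu by rewrite /Rintegral hmu.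
pose v := \int[P]_x (x ^+ 2) - mu ^+ 2.
have EX2 : \int[P]_x (x ^+ 2) = mu ^+ 2 + v by rewrite /v addrC subrK.
have v0 : 0 <= v := centered_second_moment_ge0 P mu v P1 iX iX2 EX EX2.
pose Fbar (x : R) := fine (P `]x, +oo[%classic).
have FbarE x : 0 < x -> Fbar x = L x * x `^ (- alpha) by move=> /htail; rewrite /Fbar => ->.
have Fbar_noninc x1 x2 : x1 <= x2 -> Fbar x2 <= Fbar x1.
  move=> x12; apply: fine_le; [exact: fin_num_measure|exact: fin_num_measure|].
  apply: le_measure; rewrite ?inE//.
  by move=> z /=; rewrite !in_itv/= !andbT; exact: le_lt_trans.
have alpha1 : 1 <= alpha by lra.
have eps20 : 0 < eps / 2 by rewrite divr_gt0.
have [lam lam1 hlam] := regular_tail_ratio R Fbar L alpha (eps / 2) hL alpha1 FbarE eps20.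
pose y n := gamma n - n%:R * mu.
have ysqrt := sqrt_le_of_cvg R y hgamma.
have yoo : y @ \oo --> +oo.
  apply/cvgryPge => A; near=> n.
  have n1 : 1 <= n%:R :> R by near: n; exact: nbhs_infty_ger.
  have : `|A| * Num.sqrt n%:R <= y n by near: n; exact: ysqrt.
  apply: le_trans; apply: (le_trans (ler_norm A)).
  by rewrite ler_peMr// -[leLHS]sqrtr1 ler_wsqrtr.
have /cvgryPge yge := yoo.
have tailn : \forall n \near \oo, Fbar (lam * (y n *+ 3)) <= eps / 2 * Fbar (y n *+ 3).
  have y3 : (fun n => y n *+ 3) @ \oo --> +oo.
    apply/cvgryPge => A; near=> n.
    have : `|A| <= y n by near: n; exact: yge.
    by have := ler_norm A; have := normr_ge0 A; lra.
  exact: (y3 _ hlam).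
have /cvgryPge uge := hu.
near=> n.
have n1 : 1 <= n%:R :> R by near: n; exact: nbhs_infty_ger.
have y1 : 1 <= y n by near: n; exact: yge.
have ymu : `|mu| <= y n by near: n; exact: yge.
(* Squaring gives [4 n v <= (y n)^2], because [(4 v + 1)^2 >= 4 v + 1 >= 4 v]. *)
have yK : (4 * v + 1) * Num.sqrt n%:R <= y n.
  by near: n; apply: ysqrt; rewrite addr_ge0// mulr_ge0.
(* This threshold turns [(y n)^(beta - 1)] into at least [3 lam], so that
   [u n >= (y n)^beta >= 3 lam (y n)]. *)
have ybig : (lam * 3) `^ (beta - 1)^-1 <= y n by near: n; exact: yge.
have un1 : 1 <= u n / (y n) `^ beta by near: n; exact: uge.
have Fn : Fbar (lam * (y n *+ 3)) <= eps / 2 * Fbar (y n *+ 3) by near: n.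
move: n1 y1 ymu yK ybig un1 Fn.
rewrite (_ : gamma n = n%:R * mu + y n); last by rewrite /y addrC subrK.
(* From here [n] is fixed, and the asymptotics enter only through the inequalities just
   collected. *)
move: (y n) (u n) => z w n1 y1 ymu yK ybig un1 Fn.
have y0 : 0 < z by exact: lt_le_trans y1.
have lam30 : 0 < lam * 3 by rewrite mulr_gt0// (lt_le_trans ltr01).
have wy : lam * (z *+ 3) <= w.
  have : z `^ beta <= w by move: un1; rewrite ler_pdivlMr ?powR_gt0// mul1r.
  apply: le_trans.
  rewrite (_ : beta = (beta - 1) + 1); last by ring.
  rewrite powRD; last by rewrite (gt_eqF y0) implybT.
  rewrite (powRr1 (ltW y0)) -mulr_natr mulrA mulrAC ler_wpM2r ?(ltW y0)//.
  have b10 : 0 < beta - 1 by lra.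
  have -> : lam * 3 = ((lam * 3) `^ (beta - 1)^-1) `^ (beta - 1).
    by rewrite -powRrM mulVf ?gt_eqF// powRr1// ltW.
  by apply: ge0_ler_powR; rewrite ?nnegrE ?powR_ge0//; exact: ltW.
pose q := Fbar (mu + z *+ 2).
have q0 : 0 <= q by rewrite fine_ge0// measure_ge0.
have F3q : Fbar (z *+ 3) <= q.
  by apply: Fbar_noninc; have := ler_norm mu; lra.
have Fwq : Fbar w <= eps / 2 * q.
  apply: le_trans (Fbar_noninc _ _ wy) _; apply: (le_trans Fn).
  by rewrite ler_wpM2l// ltW.
have Fwq1 : Fbar w <= q.
  apply: le_trans F3q; apply: Fbar_noninc; apply: le_trans wy.
  by rewrite ler_peMl// mulrn_wge0// ltW.
have nvy : n%:R * v / z ^+ 2 <= 1 / 4.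
  rewrite ler_pdivrMr ?exprn_gt0//.
  have s0 := sqrtr_ge0 (n%:R : R).
  have : ((4 * v + 1) * Num.sqrt n%:R) ^+ 2 <= z ^+ 2.
    by rewrite ler_sqr ?nnegrE ?(ltW y0)// mulr_ge0// addr_ge0// mulr_ge0.
  rewrite exprMn sqr_sqrtr//.
  have : (4 * v + 1) * n%:R <= (4 * v + 1) ^+ 2 * n%:R.
    by rewrite ler_wpM2r// expr2 ler_peMl//; lra.
  by lra.
(* Chebyshev at distance [z *+ 2] gives [q * (z *+ 2)^2 <= v], hence [n q <= n v / z^2]. *)
have nq : n%:R * q <= 1 / 4.
  have y20 : 0 < z *+ 2 by rewrite pmulrn_lgt0.
  have := tail_chebyshev P mu v P1 iX iX2 EX EX2 (z *+ 2) y20.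
  rewrite -/(Fbar _) -/q => qv; apply: le_trans nvy.
  rewrite ler_pdivlMr ?exprn_gt0// -mulrA ler_wpM2l//; apply: le_trans qv.
  by rewrite ler_wpM2l// ler_sqr ?nnegrE; lra.
have q4 : q <= 1 / 4.
  by apply: le_trans nq; rewrite ler_peMl.
(* Since [Fbar w <= q <= 1/4], the normalising mass is positive and the truncated law is a
   probability. *)
have Fw0 : 0 < cdfF P w.
  by have := fine_prob_gt P w; rewrite -/(Fbar w); lra.
(* With [s = 0] and [m = n mu] the squared offset vanishes, and the two losses of at most 1/4 each
   leave [p(F) >= n q / 2]. *)
have low := tail_prob_big_jump P mu v P1 iX iX2 EX EX2 (n%:R * mu) z q n 0 y0 erefl.
rewrite add0r subrr expr0n/= add0r in low.
apply: le_trans (psum_trunc_close P w Fw0 _ n) _.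
rewrite -/(Fbar w) [X in _ <= _ * `|X|](_ : _ = tail_prob P (n%:R * mu + z) n 0)//.
apply: (@le_trans _ _ (eps * (n%:R * q / 2))).
  rewrite (_ : eps * _ = n%:R * (eps / 2 * q)); last by ring.
  by rewrite ler_wpM2l.
rewrite ler_wpM2l ?(ltW eps0)//; apply: le_trans (ler_norm _); apply: le_trans low.
rewrite ler_wpM2l ?mulr_ge0//; lra.
Unshelve. all: by end_near. Qed.
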